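(* For real $q>-1$ and $x>0$ let $$V_q(x)=\frac{2e^{x^2}}{\Gamma(q+1)}\int_x^{\infty}e^{-t^2}(t^2-x^2)^q\,dt.$$ For each fixed $x>0$ the function $q\mapsto\Gamma(q+1)V_q(x)$ is strictly log-convex on $(-1,\infty)$. If $q>-1/2$ and $x>0$, then $$\frac{(q+2)(2q+1)}{(q+1)(2q+3)}V_q(x)V_{q+2}(x)<V_{q+1}^2(x)<\frac{q+2}{q+1}V_q(x)V_{q+2}(x).$$ Moreover, the right-hand inequality $V_{q+1}^2(x)<\frac{q+2}{q+1}V_q(x)V_{q+2}(x)$ is valid for all $q>-1$ and $x>0$. The left-hand inequality is sharp as $x$ tends to $0$, that is, for every $q>-1/2$, $$\lim_{x\to 0^+}\frac{V_{q+1}^2(x)}{V_q(x)V_{q+2}(x)}=\frac{(q+2)(2q+1)}{(q+1)(2q+3)}.$$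
   Context: $\Gamma$ denotes the Euler gamma function. A function $f:(-1,\infty)\to(0,\infty)$ is strictly log-convex if $f(\alpha q_1+(1-\alpha)q_2)<f(q_1)^{\alpha}f(q_2)^{1-\alpha}$ for all $q_1\neq q_2$ in $(-1,\infty)$ and all $\alpha\in(0,1)$. *)

(* Defs.v *)
From mathcomp Require Import all_boot all_order all_algebra.
From mathcomp Require Import all_classical all_reals all_analysis.
Import Order.TTheory GRing.Theory Num.Theory.
Import numFieldNormedType.Exports.

Set Implicit Arguments.
Unset Strict Implicit.
Unset Printing Implicit Defensive.

Local Open Scope classical_set_scope.
Local Open Scope ring_scope.

(* [Rintegral] is 0 when the Lebesgue integral is infinite. The integrands
   below are nonnegative and integrable for a > 0, resp. for q > -1 and x > 0,
   so there the Lebesgue integrals agree with the improper Riemann ones. *)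

Definition Gamma {R : realType} (a : R) : R :=
  \int[lebesgue_measure]_(t in `]0, +oo[) (t `^ (a - 1) * expR (- t)).

Definition V {R : realType} (q x : R) : R :=
  2 * expR (x ^+ 2) / Gamma (q + 1) *
  \int[lebesgue_measure]_(t in `]x, +oo[)
    (expR (- t ^+ 2) * (t ^+ 2 - x ^+ 2) `^ q).

Definition strictly_log_convex {R : realType} (i : interval R) (f : R -> R) :
    Prop :=
  (forall q, q \in i -> 0 < f q) /\
  (forall q1 q2 alpha, q1 \in i -> q2 \in i -> q1 != q2 ->
     alpha \in `]0, 1[ ->
     f (alpha * q1 + (1 - alpha) * q2) <
       f q1 `^ alpha * f q2 `^ (1 - alpha)).

(* Main.v *)
Require Import Defs.
From mathcomp Require Import all_boot all_order all_algebra.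
From mathcomp Require Import all_classical all_reals all_analysis.
From mathcomp Require Import measurable_realfun ring lra.
Import Order.TTheory GRing.Theory Num.Theory.
Import numFieldNormedType.Exports.

Local Open Scope classical_set_scope.
Local Open Scope ring_scope.

Set Implicit Arguments.
Unset Strict Implicit.
Unset Printing Implicit Defensive.

(** Write s = t^2 - x^2 and let [moment q x] be the integral over t > x of
    [weight q x t] = e^{-t^2} s^q, so that
    Gamma(q+1) V_q(x) = 2 e^{x^2} moment q x. Since Gamma(q+2) =
    (q+1) Gamma(q+1), every claim about V becomes one about the moments
    I_q = moment q x:

    - I is strictly log-convex in q. Young's inequality applied pointwise to
      the normalised weights of q1 and q2 is strict except at one point
      at most ([moment_log_convex]); alpha = 1/2 gives
      I_{q+1}^2 < I_q I_{q+2}, which is the upper bound.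

    - For the lower bound put B_q = [imoment q x], the integral of
      [weight q x t] / t^2. Integrating the derivative of
      e^{-t^2} s^{q+1} / t gives
        2 I_{q+1} = (2q+1) I_q + x^2 B_q          ([moment_by_parts]),
      and s / t^2 = 1 - x^2 / t^2 gives B_{q+1} = I_q - x^2 B_q. Substituting
      the identity at q and at q+1,
        2 ((2q+3) I_{q+1}^2 - (2q+1) I_q I_{q+2})
          = x^2 (2 I_{q+1} B_q
                 + (2q+1) ((I_{q+1} + x^2 I_q) B_q - I_q^2)).
      As I_{q+1} + x^2 I_q is the integral of t^2 [weight q x t], the last
      bracket is nonnegative by Cauchy-Schwarz ([moment_cauchy_schwarz]).

    - The same identity reads I_{q+1} / I_q = q + 1/2 + x^2 B_q / (2 I_q), so
      sharpness amounts to x^2 B_q / I_q -> 0 as x -> 0+. For a small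
      theta > 0 with q - theta > -1/2, x^2 B_q <= x^{2 theta} I_{q-theta}
      ([sqr_imoment_le_shift]), and I_{q-theta} <= C I_q with C independent of x
      ([moment_le_shift]). The constraint q > -1/2 is what keeps C finite.

    All integrals are Lebesgue integrals on an open half-line with integrands
    that may blow up at its endpoint. [FTC_oy] and [ge0_FTC_oy_integrable] are
    the fundamental theorem of calculus in that setting; the second one also
    yields integrability from an explicit primitive. *)

(** * The fundamental theorem of calculus on an open half-line *)

Section improper.
Context {R : realType}.
Notation mu := (@lebesgue_measure R).

(** Compact intervals that stay away from the endpoint a, where neither the
    primitive nor its derivative needs to be continuous. *)
Definition exhaust (a : R) (n : nat) : set R := `[a + n.+1%:R^-1, a + n.+2%:R].

Lemma exhaust_lt (a : R) n : a + n.+1%:R^-1 < a + n.+2%:R.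
Proof.
rewrite ltrD2l (@le_lt_trans _ _ 1)// ?ltr1n//.
by rewrite invf_le1 ?ler1n.
Qed.

Lemma nondecreasing_exhaust (a : R) :
  {homo exhaust a : n m / (n <= m)%N >-> (n <= m)%O}.
Proof.
move=> n m nm; apply/subsetPset => t; rewrite /exhaust/= !in_itv/=.
move=> /andP[h1 h2]; apply/andP; split.
  by apply: le_trans h1; rewrite lerD2l lef_pV2 ?posrE// ler_nat.
by apply: (le_trans h2); rewrite lerD2l ler_nat !ltnS.
Qed.

Lemma bigcup_exhaust (a : R) : \bigcup_n exhaust a n = `]a, +oo[%classic.
Proof.
apply/seteqP; split => t; rewrite /exhaust/=.
  by move=> [n _] /=; rewrite !in_itv/= andbT => /andP[h _]; apply: lt_le_trans h; rewrite ltrDl invr_gt0.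
rewrite in_itv/= andbT => at0.
have [n hn] : exists n : nat, (t - a)^-1 < n%:R /\ t - a < n%:R.
  exists (maxn (Num.Def.archi_bound (t - a)^-1) (Num.Def.archi_bound (t - a))).
  split; apply: lt_le_trans (archi_boundP _) _; rewrite ?ler_nat ?leq_maxl ?leq_maxr//.
    by rewrite invr_ge0 subr_ge0 ltW.
  by rewrite subr_ge0 ltW.
have n0 : 0 < t - a by rewrite subr_gt0.
exists n => //=; rewrite in_itv/=; apply/andP; split.
  rewrite -lerBrDl -[leRHS]invrK lef_pV2 ?posrE ?invr_gt0//.
  by apply: le_trans (ltW hn.1) _; rewrite ler_nat.
rewrite -lerBlDl; apply: le_trans (ltW hn.2) _.
by rewrite ler_nat -addn2 leq_addr.
Qed.

Context (a A B : R) (F f : R -> R).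
Hypothesis dF : forall t, a < t -> is_derive t 1 F (f t).
Hypothesis cf : {in `]a, +oo[%classic, continuous f}.
Hypothesis FA : F t @[t --> a^'+] --> A.
Hypothesis FB : F t @[t --> +oo] --> B.

Let FTC_exhaust n : (\int[mu]_(t in exhaust a n) (f t)%:E =
  (F (a + n.+2%:R) - F (a + n.+1%:R^-1))%:E)%E.
Proof.
have cF t : a < t -> {for t, continuous F}.
  move=> /dF[+ _]; move=> /derivable1_diffP.
  exact: differentiable_continuous.
rewrite EFinB; apply: continuous_FTC2.
- exact: exhaust_lt.
- apply: continuous_in_subspaceT => t; rewrite inE/= in_itv/= => /andP[h _].
  by apply: cf; rewrite inE/= in_itv/= andbT; apply: lt_le_trans h; rewrite ltrDl invr_gt0.
- split.
  + move=> t; rewrite in_itv/= => /andP[h _].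
    have [] : is_derive t 1 F (f t) by apply: dF; apply: lt_trans h; rewrite ltrDl invr_gt0.
    by [].
  + by apply: cvg_at_right_filter; apply: cF; rewrite ltrDl invr_gt0.
  + by apply: cvg_at_left_filter; apply: cF; rewrite ltrDl.
- move=> t; rewrite in_itv/= => /andP[h _].
  have [] : is_derive t 1 F (f t) by apply: dF; apply: lt_trans h; rewrite ltrDl invr_gt0.
  by rewrite derive1E.
Qed.

Let cvg_FTC_exhaust :
  (\int[mu]_(t in exhaust a n) (f t)%:E @[n --> \oo] --> (B - A)%:E)%E.
Proof.
rewrite (_ : (fun n => _) = EFin \o (fun n => F (a + n.+2%:R) - F (a + n.+1%:R^-1))); last first.
  by apply/funext => n; rewrite FTC_exhaust.
apply: cvg_EFin; first exact: nearW.
apply: cvgB.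
  apply: ((cvg_pinftyP F B).1 FB).
  apply/cvgryPge => r.
  near=> n; rewrite -lerBlDl.
  apply: (@le_trans _ _ n%:R); last by rewrite ler_nat -addn2 leq_addr.
  by near: n; exact: nbhs_infty_ger.
apply: ((cvg_at_rightP F a A).1 FA); split.
  by move=> n; rewrite ltrDl invr_gt0.
rewrite -[X in _ --> X]addr0; apply: cvgD; first exact: cvg_cst.
exact: cvg_harmonic.
Unshelve. all: by end_near. Qed.

Let mf : measurable_fun `]a, +oo[ f.
Proof.
apply: open_continuous_measurable_fun => //.
Qed.

Let mfE n : measurable_fun (exhaust a n) (fun t => (f t)%:E).
Proof.
apply/measurable_EFinP; apply: measurable_funS mf => //.
by rewrite -bigcup_exhaust; exact: bigcup_sup.
Qed.

(** For a nonnegative derivative monotone convergence along [exhaust] bounds the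
    integral by the finite increment of the primitive. Exhibiting a primitive is
    therefore a proof of integrability. *)
Lemma ge0_FTC_oy_integrable : (forall t, a < t -> 0 <= f t) ->
  mu.-integrable `]a, +oo[ (EFin \o f).
Proof.
move=> f0; apply/integrableP; split; first exact/measurable_EFinP.
have -> : (\int[mu]_(t in `]a, +oo[) `|(EFin \o f) t| = \int[mu]_(t in `]a, +oo[) (f t)%:E)%E.
  apply: eq_integral => t; rewrite inE/= in_itv/= andbT => at0.
  by rewrite ger0_norm// f0.
have h : (\int[mu]_(t in exhaust a n) (f t)%:E @[n --> \oo] -->
    \int[mu]_(t in \bigcup_n exhaust a n) (f t)%:E)%E.
  apply: ge0_nondecreasing_set_cvg_integral; first exact: nondecreasing_exhaust.
  - by move=> n; exact: measurable_itv.
  - exact: mfE.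
  move=> n t nt; rewrite lee_fin f0//.
  have : (\bigcup_n exhaust a n) t by exists n.
  by rewrite bigcup_exhaust/= in_itv/= andbT.
by rewrite -bigcup_exhaust (cvg_unique _ h cvg_FTC_exhaust) ?ltry.
Qed.

(** A derivative of varying sign may be only conditionally integrable;
    integrability gives the dominating function for the passage to the limit
    along [exhaust]. *)
Lemma FTC_oy : mu.-integrable `]a, +oo[ (EFin \o f) ->
  \int[mu]_(t in `]a, +oo[) f t = B - A.
Proof.
move=> fi; rewrite /Rintegral.
have mf' : measurable_fun `]a, +oo[ (fun t => (f t)%:E) by exact/measurable_EFinP.
pose fn n := (EFin \o f) \_ (exhaust a n).
have [] := @dominated_convergence _ _ R lebesgue_measure `]a, +oo[%classic (measurable_itv _)
  fn (EFin \o f) (fun t => `|f t|%:E).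
- move=> n; apply/(measurable_restrict (EFin \o f)) => //; first exact: measurable_itv.
  by apply: measurable_funS mf' => //; exact: subIsetl.
- exact/measurable_EFinP.
- apply: aeW => /= t at0.
  have [n _ nt] : (\bigcup_n exhaust a n) t by rewrite bigcup_exhaust.
  apply: cvg_near_cst; exists n => // m /= nm.
  rewrite /fn patchE ifT// inE; move: nt; apply/subsetPset; exact: nondecreasing_exhaust.
- exact: integrable_norm.
- apply: aeW => /= t n at0; rewrite /fn patchE; case: ifP => _//=.
  by rewrite normr0 lee_fin.
move=> _ _ h.
suff -> : (\int[mu]_(x in `]a, +oo[) (f x)%:E = (B - A)%:E)%E by [].
apply: (cvg_unique _ h) => //.
apply: cvg_trans cvg_FTC_exhaust; apply: near_eq_cvg; near=> n => /=.
rewrite /fn -integral_mkcondr setIidr//= -bigcup_exhaust.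
exact: bigcup_sup.
Unshelve. all: by end_near. Qed.

End improper.

(** * Derivatives and integrability on a half-line *)

Section pointwise_derivative.
Context {R : realType}.
Implicit Types (f g : R -> R) (t a b : R).

Lemma is_derive1_continuous f t a : is_derive t 1 f a -> {for t, continuous f}.
Proof.
by move=> [/derivable1_diffP df _]; exact: differentiable_continuous.
Qed.

Lemma is_derive1N f t a : is_derive t 1 f a -> is_derive t 1 (fun u => - f u) (- a).
Proof. by move=> df; exact: (@is_deriveN _ _ _ f t 1 a df). Qed.

Lemma is_derive1D f g t a b : is_derive t 1 f a -> is_derive t 1 g b ->
  is_derive t 1 (fun u => f u + g u) (a + b).
Proof. by move=> df dg; exact: (@is_deriveD _ _ _ f g t 1 a b df dg). Qed.

Lemma is_derive1M f g t a b : is_derive t 1 f a -> is_derive t 1 g b ->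
  is_derive t 1 (fun u => f u * g u) (f t * b + g t * a).
Proof. by move=> df dg; exact: (@is_deriveM _ _ f g t 1 a b df dg). Qed.

Lemma is_derive1Zr k f t a : is_derive t 1 f a ->
  is_derive t 1 (fun u => f u * k) (a * k).
Proof.
move=> df; rewrite (_ : (fun u => _) = (fun u => k * f u)); last first.
  by apply/funext => u; rewrite mulrC.
by rewrite mulrC; exact: (@is_deriveZ _ _ _ f k t 1 a df).
Qed.

Lemma is_derive1_expRN f t a : is_derive t 1 f a ->
  is_derive t 1 (fun u => expR (- f u)) (- (a * expR (- f t))).
Proof.
move=> /is_derive1N df; rewrite -mulNr mulrC.
exact: (@is_derive1_comp _ expR (fun u => - f u)).
Qed.

Lemma is_derive1_powR_comp p f t a : 0 < f t -> is_derive t 1 f a ->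
  is_derive t 1 (fun u => f u `^ p) (p * f t `^ (p - 1) * a).
Proof.
move=> f0 df; have dp := is_derive1_powR p f0.
exact: (@is_derive1_comp _ (fun s => s `^ p) f).
Qed.

End pointwise_derivative.

Section halfline_integrable.
Context {R : realType}.
Notation mu := (@lebesgue_measure R).
Implicit Types (f g : R -> R) (a k : R).

Lemma integrable_itvyZl a k f : mu.-integrable `]a, +oo[ (EFin \o f) ->
  mu.-integrable `]a, +oo[ (EFin \o (fun t => k * f t)).
Proof.
move=> fi; have h : mu.-integrable `]a, +oo[ (fun t => k%:E * (EFin \o f) t)%E.
  by apply: integrableZl fi; exact: measurable_itv.
exact: h.
Qed.

Lemma integrable_itvyD a f g :
  mu.-integrable `]a, +oo[ (EFin \o f) -> mu.-integrable `]a, +oo[ (EFin \o g) ->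
  mu.-integrable `]a, +oo[ (EFin \o (fun t => f t + g t)).
Proof.
move=> fi gi; have h : mu.-integrable `]a, +oo[ ((EFin \o f) \+ (EFin \o g))%E.
  by apply: integrableD => //; exact: measurable_itv.
exact: h.
Qed.

Lemma integrable_itvyB a f g :
  mu.-integrable `]a, +oo[ (EFin \o f) -> mu.-integrable `]a, +oo[ (EFin \o g) ->
  mu.-integrable `]a, +oo[ (EFin \o (fun t => f t - g t)).
Proof.
move=> fi gi; have h : mu.-integrable `]a, +oo[ ((EFin \o f) \- (EFin \o g))%E.
  by apply: integrableB => //; exact: measurable_itv.
exact: h.
Qed.

Lemma integrable_itvy_le a f g :
  (forall t, a < t -> {for t, continuous f}) ->
  (forall t, a < t -> 0 <= f t <= g t) ->
  mu.-integrable `]a, +oo[ (EFin \o g) -> mu.-integrable `]a, +oo[ (EFin \o f).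
Proof.
move=> cf fg; apply: le_integrable => //.
  apply/measurable_EFinP; apply: open_continuous_measurable_fun => //.
  by move=> t; rewrite inE/= in_itv/= andbT; exact: cf.
move=> t /=; rewrite in_itv/= andbT => at0; rewrite lee_fin.
have /andP[f0 fg'] := fg t at0.
by rewrite !ger0_norm// (le_trans f0).
Qed.

End halfline_integrable.

Section majorant.
Context {R : realType}.
Notation mu := (@lebesgue_measure R).

(** s <= 2p e^{s/(2p)}, raised to the power p. *)
Lemma powR_expRN_le (p : R) : 0 < p -> exists2 C, 0 < C &
  forall s : R, 0 <= s -> s `^ p * expR (- s) <= C * expR (- (s / 2)).
Proof.
move=> p0; have K0 : 0 < 2 * p by rewrite mulr_gt0.
exists ((2 * p) `^ p); first exact: powR_gt0.
move=> s s0.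
have h : s <= (2 * p) * expR (s / (2 * p)).
  rewrite -ler_pdivrMl//; apply: le_trans (expR_ge1Dx _).
  by rewrite mulrC lerDr.
have := ge0_ler_powR (ltW p0) s0 _ h.
rewrite nnegrE mulr_ge0 ?expR_ge0 ?(ltW K0)// => /(_ isT).
rewrite powRM ?expR_ge0 ?(ltW K0)// -expRM => h2.
have -> : expR (- (s / 2)) = expR (s / 2) * expR (- s).
  by rewrite -expRD; congr expR; lra.
rewrite mulrA ler_pM2r ?expR_gt0//; apply: le_trans h2 _.
rewrite (_ : s / (2 * p) * p = s / 2)//; field.
by rewrite lt0r_neq0.
Qed.

Lemma cvg_powR_expRN_at0 {T} (G : set_system T) {FG : Filter G} (p : R) (g : T -> R) :
  0 < p -> g t @[t --> G] --> (0 : R)^'+ ->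
  g t `^ p * expR (- g t) @[t --> G] --> (0 : R).
Proof.
move=> p0 g0; rewrite -(mul0r (expR (- 0))).
apply: cvgM; first exact: (cvg_comp _ _ g0 (powR_cvg0 p0)).
apply: (cvg_comp _ (fun s : R => expR (- s)) g0); apply: cvg_at_right_filter.
exact: (cvg_comp _ _ (cvgN (@cvg_id _ (nbhs (0 : R)))) (@continuous_expR R (- 0))).
Qed.

Lemma cvg_expRN_half {T} (G : set_system T) {FG : Filter G} (g : T -> R) :
  g t @[t --> G] --> +oo -> expR (- (g t / 2)) @[t --> G] --> (0 : R).
Proof.
move=> goo; apply: (cvg_comp _ (fun s : R => expR (- (s / 2))) goo).
have h : (s / 2) @[s --> +oo] --> (+oo : set_system R).
  by apply: gt0_cvgMly => //; rewrite invr_gt0.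
exact: (cvg_comp _ _ h (@cvgr_expR R)).
Qed.

Lemma cvg_powR_expRN_pinfty {T} (G : set_system T) {FG : Filter G} (p : R) (g : T -> R) :
  0 < p -> g t @[t --> G] --> +oo ->
  g t `^ p * expR (- g t) @[t --> G] --> (0 : R).
Proof.
move=> p0 goo; have [C C0 hC] := powR_expRN_le p0.
apply: (@squeeze_cvgr _ _ _ _ (fun=> 0) (fun t => C * expR (- (g t / 2)))).
- move/cvgryPge: goo => /(_ 0).
  apply: filterS => t gt0; rewrite hC// andbT.
  by rewrite mulr_ge0 ?powR_ge0 ?expR_ge0.
- exact: cvg_cst.
- rewrite -(mulr0 C); apply: cvgM; first exact: cvg_cst.
  exact: cvg_expRN_half.
Qed.

(** With C from [powR_expRN_le], g^p e^{-g} - 2 C e^{-g/2} is a primitive of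
    p g' g^{p-1} e^{-g} plus the nonnegative function
    g' (C e^{-g/2} - g^p e^{-g}). It has finite limits at both ends, so
    [ge0_FTC_oy_integrable] applies to a majorant. Taking g = id covers the Gamma
    integral, and g = t^2 - x^2 the integral defining V. *)
Lemma integrable_powR_expRN (a p : R) (g g' : R -> R) : 0 < p ->
  (forall t, a < t -> 0 < g t) ->
  (forall t, a < t -> is_derive t 1 g (g' t)) ->
  (forall t, a < t -> 0 <= g' t) ->
  (forall t, a < t -> {for t, continuous g'}) ->
  g t @[t --> a^'+] --> (0 : R)^'+ -> g t @[t --> +oo] --> +oo ->
  mu.-integrable `]a, +oo[
    (EFin \o (fun t => g' t * (g t `^ (p - 1) * expR (- g t)))).
Proof.
move=> p0 g_gt0 dg g'0 cg' g0 goo.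
have [C C0 hC] := powR_expRN_le p0.
pose F t := g t `^ p * expR (- g t) - expR (- (g t / 2)) * (2 * C).
pose f t := g' t * (p * (g t `^ (p - 1) * expR (- g t))
   + (C * expR (- (g t / 2)) - g t `^ p * expR (- g t))).
have cpow t q : a < t -> {for t, continuous (fun t => g t `^ q)}.
  move=> at0; have dp := is_derive1_powR_comp q (g_gt0 t at0) (dg t at0).
  exact: is_derive1_continuous dp.
have cexp t : a < t -> {for t, continuous (fun t => expR (- (g t / 2)))}.
  move=> at0; have de := is_derive1_expRN (is_derive1Zr 2^-1 (dg t at0)).
  exact: is_derive1_continuous de.
have cexp1 t : a < t -> {for t, continuous (fun t => expR (- g t))}.
  move=> at0; have de := is_derive1_expRN (dg t at0).
  exact: is_derive1_continuous de.
have fi : mu.-integrable `]a, +oo[ (EFin \o f).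
  apply: (@ge0_FTC_oy_integrable R a (- (2 * C)) 0 F f).
  - move=> t at0; have gt0 := g_gt0 t at0; have dgt := dg t at0.
    have de := is_derive1_expRN dgt.
    have dp := is_derive1_powR_comp p gt0 dgt.
    have dF := is_derive1D (is_derive1M dp de)
      (is_derive1N (is_derive1Zr (2 * C) (is_derive1_expRN (is_derive1Zr 2^-1 dgt)))).
    apply: (is_derive_eq dF).
    rewrite /f; move: (expR _) (expR _) (_ `^ _) (_ `^ _) => u v w z.
    by field.
  - move=> t; rewrite inE/= in_itv/= andbT => at0.
    apply: cvgM; first exact: cg'.
    apply: cvgD.
      apply: cvgM; first exact: cvg_cst.
      by apply: cvgM; [exact: cpow|exact: cexp1].
    apply: cvgB.
      by apply: cvgM; [exact: cvg_cst|exact: cexp].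
    by apply: cvgM; [exact: cpow|exact: cexp1].
  - rewrite -[- (2 * C)]add0r; apply: cvgB.
      exact: cvg_powR_expRN_at0.
    have h : expR (- (g t / 2)) @[t --> a^'+] --> expR (- (0 / 2)).
      apply: (cvg_comp _ (fun s : R => expR (- (s / 2))) g0); apply: cvg_at_right_filter.
      apply: (@continuous_comp _ _ _ (fun t : R => - (t / 2)) expR); last exact: continuous_expR.
      by apply: cvgN; apply: cvgM; [exact: (@cvg_id _ (nbhs (0 : R)))|exact: cvg_cst].
    rewrite mul0r oppr0 expR0 in h.
    have := cvgM h (@cvg_cst _ (2 * C) _ (a^'+) _); rewrite mul1r.
    by apply; apply: at_right_proper_filter.
  - rewrite -(subr0 0); apply: cvgB.
      exact: cvg_powR_expRN_pinfty.
    rewrite -(mul0r (2 * C)); apply: cvgM; last exact: cvg_cst.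
    exact: cvg_expRN_half.
  - move=> t at0; rewrite /f mulr_ge0 ?g'0// addr_ge0//.
      by rewrite !mulr_ge0 ?powR_ge0 ?expR_ge0 ?(ltW p0).
    by rewrite subr_ge0 hC// ltW// g_gt0.
apply: integrable_itvy_le (integrable_itvyZl p^-1 fi) => t at0.
  apply: cvgM; first exact: cg'.
  by apply: cvgM; [exact: cpow|exact: cexp1].
have h0 : 0 <= g t `^ (p - 1) * expR (- g t) by rewrite mulr_ge0 ?powR_ge0 ?expR_ge0.
have h1 : 0 <= C * expR (- (g t / 2)) - g t `^ p * expR (- g t).
  by rewrite subr_ge0 hC// ltW// g_gt0.
rewrite mulr_ge0 ?g'0//= /f [leRHS]mulrCA; apply: ler_wpM2l; first exact: g'0.
rewrite mulrDr mulKf ?lt0r_neq0// lerDl.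
by rewrite mulr_ge0// invr_ge0 ltW.
Qed.

(** Strictness beyond some point c is enough, because `]c, +oo[ has nonzero
    measure. *)
Lemma lt_Rintegral_itvy (a c : R) (f g : R -> R) :
  mu.-integrable `]a, +oo[ (EFin \o f) -> mu.-integrable `]a, +oo[ (EFin \o g) ->
  (forall t, a < t -> f t <= g t) ->
  (forall t, a < t -> c < t -> f t < g t) ->
  \int[mu]_(t in `]a, +oo[) f t < \int[mu]_(t in `]a, +oo[) g t.
Proof.
move=> fi gi fg fgc.
rewrite lt_neqAle; apply/andP; split; last first.
  by apply: le_Rintegral => // t /=; rewrite in_itv/= andbT; exact: fg.
apply/eqP => e.
have hi := integrable_itvyB gi fi.
have h0 : (\int[mu]_(t in `]a, +oo[) `|(EFin \o (fun t => (g t - f t)%R)) t| = 0)%E.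
  rewrite (_ : 0%E = (\int[mu]_(t in `]a, +oo[) (g t - f t))%:E); last first.
    by rewrite RintegralB// e subrr.
  rewrite /Rintegral fineK; last by apply: integrable_fin_num hi.
  apply: eq_integral => t; rewrite inE/= in_itv/= andbT => at0.
  by rewrite ger0_norm// subr_ge0 fg.
move: h0 => /ae_eq_integral_abs => /(_ (measurable_itv _) (measurable_int _ hi)).
move=> [N [mN N0 sub]].
have : (mu `]Num.max a c, +oo[ <= mu N)%E.
  apply: le_measure; rewrite ?inE//.
  apply: subset_trans sub => t /=; rewrite in_itv/= andbT gt_max => /andP[at0 ct].
  move=> /(_ _); rewrite in_itv/= andbT => /(_ at0) /eqP.
  by rewrite eqe subr_eq0 gt_eqF// fgc.
by rewrite N0 lebesgue_measure_itv/= ltry.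
Qed.
End majorant.

(** * The Gamma function *)

Section gamma.
Context {R : realType}.
Notation mu := (@lebesgue_measure R).

Lemma integrable_Gamma (a : R) : 0 < a ->
  mu.-integrable `]0, +oo[ (EFin \o (fun t => t `^ (a - 1) * expR (- t))).
Proof.
move=> a0; have h := @integrable_powR_expRN R 0 a id (fun=> 1) a0 (fun _ => id)
  (fun t _ => is_derive_id t 1) (fun _ _ => ler01) (fun t _ => @cvg_cst _ _ _ _ _)
  cvg_id cvg_id.
rewrite (_ : (fun t => _) = fun t => 1 * (t `^ (a - 1) * expR (- t))); first exact: h.
by apply/funext => t; rewrite mul1r.
Qed.

Lemma Gamma_gt0 (a : R) : 0 < a -> 0 < Gamma a.
Proof.
move=> a0; have h : \int[mu]_(t in `]0, +oo[) (0 : R) < Gamma a.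
  apply: (@lt_Rintegral_itvy R 0 0 (fun=> 0)); last 2 first.
  - by move=> t _; rewrite mulr_ge0 ?powR_ge0 ?expR_ge0.
  - by move=> t t0 _; rewrite mulr_gt0 ?powR_gt0 ?expR_gt0.
  - by apply: integrable0.
  - exact: integrable_Gamma.
apply: le_lt_trans h.
by rewrite Rintegral_ge0.
Qed.

(** The derivative of t^a e^{-t}, which vanishes at both ends, integrates to
    0. *)
Lemma GammaD1 (a : R) : 0 < a -> Gamma (a + 1) = a * Gamma a.
Proof.
move=> a0.
pose F t := t `^ a * expR (- t).
pose f t := a * (t `^ (a - 1) * expR (- t)) - t `^ a * expR (- t).
have i1 := integrable_Gamma a0.
have i2 : mu.-integrable `]0, +oo[ (EFin \o (fun t => t `^ a * expR (- t))).
  have a10 : 0 < a + 1 by rewrite addr_gt0.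
  by have := integrable_Gamma a10; rewrite addrK.
have i3 := integrable_itvyZl a i1.
have h : \int[mu]_(t in `]0, +oo[) f t = 0 - 0.
  apply: (@FTC_oy R 0 0 0 F).
  - move=> t t0.
    have := is_derive1M (is_derive1_powR a t0) (is_derive1_expRN (is_derive_id t 1)).
    move=> /is_derive_eq; apply; rewrite /f; lra.
  - move=> t; rewrite inE/= in_itv/= andbT => t0.
    have de := is_derive1_expRN (is_derive_id t 1).
    have d1 := is_derive1M (is_derive1_powR (a - 1) t0) de.
    have d2 := is_derive1M (is_derive1_powR a t0) de.
    have d3 := is_derive1D (is_derive1Zr a d1) (is_derive1N d2).
    rewrite /f; under eq_fun do rewrite mulrC.
    exact: is_derive1_continuous d3.
  - by apply: cvg_powR_expRN_at0 => //; exact: cvg_id.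
  - by apply: cvg_powR_expRN_pinfty => //; exact: cvg_id.
  - exact: integrable_itvyB.
move: h; rewrite subr0 /f RintegralB// RintegralZl// => /eqP.
by rewrite subr_eq0 /Gamma addrK => /eqP ->.
Qed.

End gamma.

(** * The moments and integration by parts *)

Section moments.
Context {R : realType}.
Notation mu := (@lebesgue_measure R).
Implicit Types (q x t : R).

Definition weight q x t : R := expR (- t ^+ 2) * (t ^+ 2 - x ^+ 2) `^ q.

Definition moment q x : R := \int[mu]_(t in `]x, +oo[) weight q x t.

Definition imoment q x : R := \int[mu]_(t in `]x, +oo[) (weight q x t / t ^+ 2).

Lemma weight_ge0 q x t : 0 <= weight q x t.
Proof. by rewrite mulr_ge0 ?expR_ge0 ?powR_ge0. Qed.

Lemma subr_sqr_gt0 x t : 0 < x -> x < t -> 0 < t ^+ 2 - x ^+ 2.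
Proof. by move=> x0 xt; rewrite subr_gt0 ltr_pXn2r ?nnegrE ?(ltW x0) ?(ltW (lt_trans x0 xt)). Qed.

Lemma weight_gt0 q x t : 0 < x -> x < t -> 0 < weight q x t.
Proof. by move=> x0 xt; rewrite mulr_gt0 ?expR_gt0 ?powR_gt0 ?subr_sqr_gt0. Qed.

Lemma weightD q r x t : 0 < x -> x < t ->
  weight (q + r) x t = weight q x t * (t ^+ 2 - x ^+ 2) `^ r.
Proof.
move=> x0 xt; have s0 := subr_sqr_gt0 x0 xt.
by rewrite /weight powRD ?mulrA// (gt_eqF s0) implybT.
Qed.

Lemma weightD1 q x t : 0 < x -> x < t ->
  weight (q + 1) x t = weight q x t * (t ^+ 2 - x ^+ 2).
Proof.
by move=> x0 xt; rewrite weightD// powRr1// ltW// subr_sqr_gt0.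
Qed.

Lemma weight_expRN q x t : weight q x t =
  expR (- x ^+ 2) * ((t ^+ 2 - x ^+ 2) `^ q * expR (- (t ^+ 2 - x ^+ 2))).
Proof.
by rewrite /weight mulrCA -expRD mulrC; congr (_ * expR _); ring.
Qed.

Lemma is_derive1_sqrB x t : is_derive t 1 (fun u => u ^+ 2 - x ^+ 2) (2 * t).
Proof.
have d := is_derive1D (is_derive1M (is_derive_id t 1) (is_derive_id t 1))
  (@is_derive_cst _ _ _ (- x ^+ 2) t 1).
by apply: (is_derive_eq d) => /=; rewrite /id; ring.
Qed.

Lemma is_derive1_weight q x t : 0 < x -> x < t ->
  is_derive t 1 (weight q x)
    (2 * t * (q * (expR (- t ^+ 2) * (t ^+ 2 - x ^+ 2) `^ (q - 1)) - weight q x t)).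
Proof.
move=> x0 xt; have s0 := subr_sqr_gt0 x0 xt.
have de : is_derive t 1 (fun u => expR (- u ^+ 2)) (- (2 * t * expR (- t ^+ 2))).
  have d := is_derive1_expRN (is_derive1M (is_derive_id t 1) (is_derive_id t 1)).
  by apply: (is_derive_eq d) => /=; rewrite /id expr2; ring.
have dp := @is_derive1_powR_comp R q (fun u => u ^+ 2 - x ^+ 2) t _ s0 (is_derive1_sqrB x t).
have d := is_derive1M de dp.
apply: (is_derive_eq d); rewrite /weight; ring.
Qed.

Lemma cvg_sqrB_at_right x : 0 < x ->
  t ^+ 2 - x ^+ 2 @[t --> x^'+] --> (0 : R)^'+.
Proof.
move=> x0.
have h : t ^+ 2 - x ^+ 2 @[t --> x] --> (0 : R).
  rewrite -(subrr (x ^+ 2)).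
  have := is_derive1_continuous (is_derive1_sqrB x x). exact.
move=> P P0; change (\forall t \near x, x < t -> P (t ^+ 2 - x ^+ 2)).
have {}h : \forall t \near x, 0 < t ^+ 2 - x ^+ 2 -> P (t ^+ 2 - x ^+ 2) := h _ P0.
apply: filterS h => t Pt xt; apply: Pt.
exact: subr_sqr_gt0.
Qed.

Lemma cvg_sqrB_pinfty x : t ^+ 2 - x ^+ 2 @[t --> +oo] --> +oo.
Proof.
apply/cvgryPge => A; near=> t.
have t1 : 1 <= t by near: t; exact: nbhs_pinfty_ge.
have t2 : A + x ^+ 2 <= t by near: t; apply: nbhs_pinfty_ge; rewrite num_real.
rewrite lerBrDr (le_trans t2)// expr2 ler_peMr// (le_trans ler01).
Unshelve. all: by end_near. Qed.

(** [integrable_powR_expRN] carries the extra factor g' t = 2 t, which is at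
    least 2 x on the half-line. *)
Lemma integrable_weight q x : -1 < q -> 0 < x ->
  mu.-integrable `]x, +oo[ (EFin \o weight q x).
Proof.
move=> q1 x0; have p0 : 0 < q + 1 by lra.
have := @integrable_powR_expRN R x (q + 1) (fun t => t ^+ 2 - x ^+ 2) (fun t => 2 * t) p0
  (fun t => @subr_sqr_gt0 x t x0) (fun t _ => is_derive1_sqrB x t).
have h1 t : x < t -> 0 <= 2 * t by move=> xt; rewrite mulr_ge0// ltW// (lt_trans x0).
have h2 t : x < t -> {for t, continuous (fun t => 2 * t : R)}.
  by move=> _; apply: cvgM; [exact: cvg_cst|exact: cvg_id].
move=> /(_ h1 h2 (cvg_sqrB_at_right x0) (@cvg_sqrB_pinfty x)).
rewrite addrK => /(integrable_itvyZl (expR (- x ^+ 2) / (2 * x))).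
apply: integrable_itvy_le => t xt.
  exact: is_derive1_continuous (is_derive1_weight q x0 xt).
rewrite weight_ge0/= weight_expRN.
have -> : expR (- x ^+ 2) / (2 * x) *
  (2 * t * ((t ^+ 2 - x ^+ 2) `^ q * expR (- (t ^+ 2 - x ^+ 2)))) =
  (t / x) * (expR (- x ^+ 2) * ((t ^+ 2 - x ^+ 2) `^ q * expR (- (t ^+ 2 - x ^+ 2)))).
  by field; rewrite lt0r_neq0.
rewrite ler_peMl ?mulr_ge0 ?expR_ge0 ?powR_ge0//.
by rewrite ler_pdivlMr// mul1r ltW.
Qed.

Lemma is_derive1_weight_div q x t : 0 < x -> x < t ->
  is_derive t 1 (fun u => weight (q + 1) x u * u `^ (-1))
    ((2 * q + 1) * weight q x t + x ^+ 2 * (weight q x t / t ^+ 2)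
      - 2 * weight (q + 1) x t).
Proof.
move=> x0 xt; have t0 := lt_trans x0 xt.
have d := is_derive1M (is_derive1_weight (q + 1) x0 xt) (is_derive1_powR (-1) t0).
apply: (is_derive_eq d).
rewrite addrK -/(weight q x t) weightD1//.
rewrite (_ : t `^ (-1) = t^-1); last by rewrite powR_inv1 ?ltW.
rewrite (_ : -1 - 1 = - 2%:R :> R); last by ring.
rewrite powR_invn ?ltW//.
by field; rewrite lt0r_neq0.
Qed.

Lemma integrable_weight_div q x : -1 < q -> 0 < x ->
  mu.-integrable `]x, +oo[ (EFin \o (fun t => weight q x t / t ^+ 2)).
Proof.
move=> q1 x0; have := integrable_itvyZl (x ^- 2) (integrable_weight q1 x0).
apply: integrable_itvy_le => t xt; have t0 := lt_trans x0 xt.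
  apply: cvgM; first exact: is_derive1_continuous (is_derive1_weight q x0 xt).
  apply: cvgV; first by rewrite expf_neq0// lt0r_neq0.
  by apply: cvgM; exact: cvg_id.
rewrite mulr_ge0 ?weight_ge0 ?invr_ge0 ?exprn_ge0 ?(ltW t0)//= mulrC.
apply: ler_wpM2r; first exact: weight_ge0.
rewrite lef_pV2 ?posrE ?exprn_gt0//.
by rewrite lerXn2r ?nnegrE ?(ltW x0) ?(ltW t0) ?(ltW xt).
Qed.

(** The integrand of [is_derive1_weight_div] has total integral 0, since its
    primitive e^{-t^2} s^{q+1} / t vanishes at x (because q + 1 > 0) and at
    infinity. *)
Lemma moment_by_parts q x : -1 < q -> 0 < x ->
  2 * moment (q + 1) x = (2 * q + 1) * moment q x + x ^+ 2 * imoment q x.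
Proof.
move=> q1 x0; have p0 : 0 < q + 1 by lra.
have q2 : -1 < q + 1 by lra.
have i1 := integrable_weight q1 x0.
have i2 := integrable_weight_div q1 x0.
have i3 := integrable_weight q2 x0.
have i1' := integrable_itvyZl (2 * q + 1) i1.
have i2' := integrable_itvyZl (x ^+ 2) i2.
have i3' := integrable_itvyZl 2 i3.
have cvg0 (G : set_system R) (FG : Filter G) : (\forall t \near G, x < t) ->
  (t ^+ 2 - x ^+ 2) `^ (q + 1) * expR (- (t ^+ 2 - x ^+ 2)) @[t --> G] --> (0 : R) ->
  weight (q + 1) x t * t `^ (-1) @[t --> G] --> (0 : R).
  move=> xG h.
  apply: (@squeeze_cvgr _ _ _ _ (fun=> 0) (fun t => expR (- x ^+ 2) / x *
    ((t ^+ 2 - x ^+ 2) `^ (q + 1) * expR (- (t ^+ 2 - x ^+ 2))))).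
  - apply: filterS xG => t xt; have t0 := lt_trans x0 xt.
    rewrite mulr_ge0 ?weight_ge0 ?powR_ge0//= powR_inv1 ?(ltW t0)// weight_expRN.
    rewrite [leRHS]mulrAC ler_wpM2l ?mulr_ge0 ?expR_ge0 ?powR_ge0//.
    by rewrite lef_pV2 ?posrE// ltW.
  - exact: cvg_cst.
  - by have := cvgM (@cvg_cst _ (expR (- x ^+ 2) / x) _ G _) h; rewrite mulr0; apply.
have h : \int[mu]_(t in `]x, +oo[) ((2 * q + 1) * weight q x t + x ^+ 2 * (weight q x t / t ^+ 2)
      - 2 * weight (q + 1) x t) = 0 - 0.
  apply: (@FTC_oy R x 0 0 (fun u => weight (q + 1) x u * u `^ (-1))).
  - by move=> t xt; exact: is_derive1_weight_div.
  - move=> t; rewrite inE/= in_itv/= andbT => xt; have t0 := lt_trans x0 xt.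
    have cw r : {for t, continuous (weight r x)}.
      exact: is_derive1_continuous (is_derive1_weight r x0 xt).
    apply: cvgB; last by apply: cvgM; [exact: cvg_cst|exact: cw].
    apply: cvgD; first by apply: cvgM; [exact: cvg_cst|exact: cw].
    apply: cvgM; first exact: cvg_cst.
    apply: cvgM; first exact: cw.
    apply: cvgV; first by rewrite expf_neq0// lt0r_neq0.
    by apply: cvgM; exact: cvg_id.
  - apply: cvg0; first exact: nbhs_right_gt.
    by apply: cvg_powR_expRN_at0 => //; exact: cvg_sqrB_at_right.
  - apply: cvg0; first by apply: nbhs_pinfty_gt; rewrite num_real.
    by apply: cvg_powR_expRN_pinfty => //; exact: cvg_sqrB_pinfty.
  - by apply: integrable_itvyB => //; exact: integrable_itvyD.
move: h; rewrite subr0 RintegralB//; last exact: integrable_itvyD.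
rewrite RintegralD// !RintegralZl// => /eqP.
by rewrite subr_eq0 => /eqP <-.
Qed.

Lemma moment_gt0 q x : -1 < q -> 0 < x -> 0 < moment q x.
Proof.
move=> q1 x0; have h : \int[mu]_(t in `]x, +oo[) (0 : R) < moment q x.
  apply: (@lt_Rintegral_itvy R x x (fun=> 0)); last 2 first.
  - by move=> t xt; exact: weight_ge0.
  - by move=> t xt _; exact: weight_gt0.
  - exact: integrable0.
  - exact: integrable_weight.
by apply: le_lt_trans h; rewrite Rintegral_ge0.
Qed.

Lemma imoment_gt0 q x : -1 < q -> 0 < x -> 0 < imoment q x.
Proof.
move=> q1 x0; have h : \int[mu]_(t in `]x, +oo[) (0 : R) < imoment q x.
  apply: (@lt_Rintegral_itvy R x x (fun=> 0)); last 2 first.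
  - move=> t xt; have t0 := lt_trans x0 xt.
    by rewrite mulr_ge0 ?weight_ge0 ?invr_ge0 ?exprn_ge0 ?(ltW t0).
  - move=> t xt _; have t0 := lt_trans x0 xt.
    by rewrite mulr_gt0 ?weight_gt0 ?invr_gt0 ?exprn_gt0.
  - exact: integrable0.
  - exact: integrable_weight_div.
by apply: le_lt_trans h; rewrite Rintegral_ge0.
Qed.

(** s / t^2 = 1 - x^2 / t^2. *)
Lemma imomentD1 q x : -1 < q -> 0 < x ->
  imoment (q + 1) x = moment q x - x ^+ 2 * imoment q x.
Proof.
move=> q1 x0.
have i1 := integrable_weight q1 x0.
have i2 := integrable_weight_div q1 x0.
rewrite /imoment /moment -RintegralZl// -RintegralB//; last exact: integrable_itvyZl.
apply: eq_Rintegral => t; rewrite inE/= in_itv/= andbT => xt.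
rewrite weightD1//; field; rewrite lt0r_neq0//; exact: lt_trans xt.
Qed.

End moments.

(** * Log-convexity and the moment inequalities *)

Section young.
Context {R : realType}.
Implicit Types (a b alpha : R).

Lemma powR_div a b alpha : 0 <= a -> 0 <= b -> (a / b) `^ alpha = a `^ alpha / b `^ alpha.
Proof.
by move=> a0 b0; rewrite powRM ?invr_ge0// -powR_inv1// -powRrM mulN1r powRN.
Qed.

Lemma powR_mul1B a alpha : 0 < a -> a `^ alpha * a `^ (1 - alpha) = a.
Proof.
move=> a0; rewrite -powRD ?(gt_eqF a0) ?implybT//.
by rewrite addrC subrK powRr1// ltW.
Qed.

(** With m = a^alpha b^(1-alpha) and d = ln a - ln b, a = m e^{(1-alpha) d} and
    b = m e^{-alpha d}. The tangent bound 1 + u < e^u at the two exponents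
    averages to 1. *)
Lemma powR_young_lt a b alpha : 0 < a -> 0 < b -> 0 < alpha < 1 -> a != b ->
  a `^ alpha * b `^ (1 - alpha) < alpha * a + (1 - alpha) * b.
Proof.
move=> a0 b0 /andP[al0 al1] ab.
pose d := ln a - ln b.
have d0 : d != 0.
  by rewrite subr_eq0; apply: contra_neq ab => /ln_inj; rewrite !posrE; exact.
set m := a `^ alpha * b `^ (1 - alpha).
have m0 : 0 < m by rewrite mulr_gt0 ?powR_gt0.
have Em : m = expR (alpha * ln a + (1 - alpha) * ln b).
  by rewrite expRD /m /powR !gt_eqF.
have Ea : a = m * expR ((1 - alpha) * d).
  rewrite Em -expRD -[LHS]lnK ?posrE//; congr expR; rewrite /d; ring.
have Eb : b = m * expR (- alpha * d).
  rewrite Em -expRD -[LHS]lnK ?posrE//; congr expR; rewrite /d; ring.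
rewrite {1}Ea {1}Eb.
have h1 : 1 + (1 - alpha) * d < expR ((1 - alpha) * d).
  by apply: expR_gt1Dx; rewrite mulf_neq0// subr_eq0 gt_eqF.
have h2 : 1 + (- alpha * d) < expR (- alpha * d).
  by apply: expR_gt1Dx; rewrite mulf_neq0// oppr_eq0 gt_eqF.
have h3 : 1 < alpha * expR ((1 - alpha) * d) + (1 - alpha) * expR (- alpha * d).
  have al1' : 0 < 1 - alpha by lra.
  have k1 := h1; rewrite -(ltr_pM2l al0) in k1.
  have k2 := h2; rewrite -(ltr_pM2l al1') in k2.
  apply: le_lt_trans (ltrD k1 k2).
  rewrite le_eqVlt; apply/orP; left; apply/eqP; ring.
rewrite -[ltLHS]mulr1.
have -> : alpha * (m * expR ((1 - alpha) * d)) + (1 - alpha) * (m * expR (- alpha * d)) =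
  m * (alpha * expR ((1 - alpha) * d) + (1 - alpha) * expR (- alpha * d)) by ring.
by rewrite ltr_pM2l.
Qed.

Lemma powR_young_le a b alpha : 0 < a -> 0 < b -> 0 < alpha < 1 ->
  a `^ alpha * b `^ (1 - alpha) <= alpha * a + (1 - alpha) * b.
Proof.
move=> a0 b0 al; have [->|ab] := eqVneq a b; last exact/ltW/powR_young_lt.
by rewrite powR_mul1B// -mulrDl addrC subrK mul1r.
Qed.

End young.

Section moment_inequalities.
Context {R : realType}.
Notation mu := (@lebesgue_measure R).
Implicit Types (q x t : R).

Lemma weight_convex q1 q2 alpha x t : 0 < x -> x < t ->
  weight (alpha * q1 + (1 - alpha) * q2) x t =
  weight q1 x t `^ alpha * weight q2 x t `^ (1 - alpha).
Proof.
move=> x0 xt; have s0 := subr_sqr_gt0 x0 xt.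
rewrite /weight !powRM ?expR_ge0 ?powR_ge0// mulrACA powR_mul1B ?expR_gt0//.
rewrite -!powRrM -powRD ?(gt_eqF s0) ?implybT//.
by rewrite [q1 * _]mulrC [q2 * _]mulrC.
Qed.

(** The normalised weights of two different exponents agree for at most one
    value of t, which is what makes the integrated Young inequality strict. *)
Lemma weight_ratio_inj q1 q2 U W x t : 0 < x -> x < t -> 0 < U -> 0 < W -> q1 != q2 ->
  weight q1 x t / U = weight q2 x t / W ->
  t ^+ 2 - x ^+ 2 = (U / W) `^ (q1 - q2)^-1.
Proof.
move=> x0 xt U0 W0 q12; have s0 := subr_sqr_gt0 x0 xt.
rewrite /weight; set s := _ - _ => E.
have {}E : s `^ (q1 - q2) = U / W.
  rewrite powRB; last by rewrite (gt_eqF s0) implybT.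
  have e0 : expR (- t ^+ 2) != 0 by rewrite gt_eqF ?expR_gt0.
  have n2 : s `^ q2 != 0 by rewrite gt_eqF ?powR_gt0.
  have U1 : U != 0 by rewrite gt_eqF.
  have W1 : W != 0 by rewrite gt_eqF.
  apply/eqP; rewrite eqr_div//; apply/eqP; apply: (mulfI e0).
  move/eqP: E; rewrite eqr_div// => /eqP.
  by rewrite -!mulrA [s `^ q2 * U]mulrC.
by rewrite -E -powRrM mulfV ?subr_eq0// powRr1// ltW.
Qed.

Lemma moment_log_convex q1 q2 alpha x : 0 < x -> -1 < q1 -> -1 < q2 -> q1 != q2 ->
  0 < alpha < 1 ->
  moment (alpha * q1 + (1 - alpha) * q2) x < moment q1 x `^ alpha * moment q2 x `^ (1 - alpha).
Proof.
move=> x0 q1_gt q2_gt q12 al; have /andP[al0 al1] := al.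
have q_gt : -1 < alpha * q1 + (1 - alpha) * q2.
  have : 0 < alpha * (q1 + 1) + (1 - alpha) * (q2 + 1).
    by rewrite addr_gt0// mulr_gt0//; lra.
  lra.
set q := alpha * q1 + _; set U := moment q1 x; set W := moment q2 x.
have U0 : 0 < U by exact: moment_gt0.
have W0 : 0 < W by exact: moment_gt0.
set m := U `^ alpha * _.
have m0 : 0 < m by rewrite mulr_gt0 ?powR_gt0.
have i0 := integrable_weight q_gt x0.
have i1 := integrable_weight q1_gt x0.
have i2 := integrable_weight q2_gt x0.
have j0 := integrable_itvyZl m^-1 i0.
have j1 := integrable_itvyZl (alpha / U) i1.
have j2 := integrable_itvyZl ((1 - alpha) / W) i2.
have E t : x < t -> m^-1 * weight q x t =
    (weight q1 x t / U) `^ alpha * (weight q2 x t / W) `^ (1 - alpha).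
  move=> xt; rewrite !powR_div ?weight_ge0 ?(ltW U0) ?(ltW W0)//.
  by rewrite mulrACA -weight_convex// -invfM mulrC.
have E2 t : alpha / U * weight q1 x t + (1 - alpha) / W * weight q2 x t =
    alpha * (weight q1 x t / U) + (1 - alpha) * (weight q2 x t / W).
  by congr (_ + _); rewrite mulrAC -mulrA.
have : \int[mu]_(t in `]x, +oo[) (m^-1 * weight q x t) < \int[mu]_(t in `]x, +oo[)
    (alpha / U * weight q1 x t + (1 - alpha) / W * weight q2 x t).
  (* Beyond this point t <= t^2 forces s to exceed the only value of s at
     which the two normalised weights can agree. *)
  apply: (@lt_Rintegral_itvy R x (1 + x ^+ 2 + (U / W) `^ (q1 - q2)^-1)) => //.
  - exact: integrable_itvyD.
  - move=> t xt; rewrite E// E2.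
    by apply: powR_young_le; rewrite ?divr_gt0 ?weight_gt0.
  - move=> t xt ct; rewrite E// E2.
    apply: powR_young_lt; rewrite ?divr_gt0 ?weight_gt0//.
    apply/eqP => /weight_ratio_inj => /(_ x0 xt U0 W0 q12) e.
    have k0 := powR_ge0 (U / W) (q1 - q2)^-1.
    have x20 := sqr_ge0 x.
    move: ct k0; rewrite -e => ct k0.
    have : t ^+ 2 < t by lra.
    by apply/negP; rewrite -leNgt expr2 ler_peMr; lra.
rewrite RintegralD// !RintegralZl//.
rewrite -/(moment q x) -/(moment q1 x) -/(moment q2 x) -/U -/W.
rewrite !divfK ?gt_eqF// addrC subrK => h.
by rewrite -[ltRHS]mulr1 -ltr_pdivrMl.
Qed.

Lemma moment_sqr_lt q x : -1 < q -> 0 < x ->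
  moment (q + 1) x ^+ 2 < moment q x * moment (q + 2) x.
Proof.
move=> q1 x0; have q3 : -1 < q + 2 by lra.
have q2 : -1 < q + 1 by lra.
have q12 : q != q + 2 by lra.
have := @moment_log_convex q (q + 2) 2^-1 x x0 q1 q3 q12.
rewrite (_ : 2^-1 * q + _ = q + 1); last by field.
rewrite (_ : 1 - 2^-1 = 2^-1); last by field.
have m0 := moment_gt0 q1 x0; have m1 := moment_gt0 q2 x0; have m2 := moment_gt0 q3 x0.
rewrite !powR12_sqrt ?ltW// => h.
have : moment (q + 1) x < Num.sqrt (moment q x) * Num.sqrt (moment (q + 2) x).
  by apply: h; lra.
rewrite -(@ltr_pXn2r _ 2)// ?nnegrE ?mulr_ge0 ?sqrtr_ge0 ?(ltW m1)//.
by rewrite exprMn !sqr_sqrtr ?(ltW m0) ?(ltW m2).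
Qed.

(** Cauchy-Schwarz for t and 1/t against the weight: the integral of
    weight * (N / t - I t)^2, with N the integral of t^2 weight and
    I = moment q x, equals N (N B - I^2), B = imoment q x. *)
Lemma moment_cauchy_schwarz q x : -1 < q -> 0 < x ->
  moment q x ^+ 2 <= (moment (q + 1) x + x ^+ 2 * moment q x) * imoment q x.
Proof.
move=> q1 x0; have q2 : -1 < q + 1 by lra.
have m0 := moment_gt0 q1 x0; have m1 := moment_gt0 q2 x0.
have i0 := integrable_weight q1 x0.
have i1 := integrable_weight q2 x0.
have i2 := integrable_weight_div q1 x0.
set I := moment q x; set N := _ + _.
have N0 : 0 < N by rewrite addr_gt0// mulr_gt0// exprn_gt0.
have j0 := integrable_itvyZl (I ^+ 2 * x ^+ 2 - 2 * N * I) i0.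
have j1 := integrable_itvyZl (I ^+ 2) i1.
have j2 := integrable_itvyZl (N ^+ 2) i2.
have j3 := integrable_itvyD j1 j2.
have : 0 <= \int[mu]_(t in `]x, +oo[) ((I ^+ 2 * x ^+ 2 - 2 * N * I) * weight q x t
    + (I ^+ 2 * weight (q + 1) x t + N ^+ 2 * (weight q x t / t ^+ 2))).
  apply: Rintegral_ge0 => t; rewrite /= in_itv/= andbT => xt.
  rewrite weightD1// (_ : _ + _ = weight q x t * (N / t - I * t) ^+ 2).
    by rewrite mulr_ge0 ?weight_ge0 ?sqr_ge0.
  by field; rewrite lt0r_neq0//; exact: lt_trans xt.
rewrite RintegralD// RintegralD// !RintegralZl//.
rewrite -/(moment q x) -/(moment (q + 1) x) -/(imoment q x) -/I.
have EN : moment (q + 1) x = N - x ^+ 2 * I by rewrite addrK.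
rewrite EN; move: (x ^+ 2) (imoment q x) => y B h.
have {}h : 0 <= N * (N * B - I ^+ 2).
  by rewrite (le_trans h)// le_eqVlt; apply/orP; left; apply/eqP; ring.
by move: h; rewrite pmulr_rge0// subr_ge0.
Qed.

(** Eliminating moment (q + 2) x by [moment_by_parts] at q + 1 leaves x^2 times
    2 moment (q+1) x * imoment q x plus a multiple 2q+1 > 0 of the gap in
    [moment_cauchy_schwarz]. *)
Lemma moment_sqr_gt q x : - (1 / 2) < q -> 0 < x ->
  (2 * q + 1) * (moment q x * moment (q + 2) x) < (2 * q + 3) * moment (q + 1) x ^+ 2.
Proof.
move=> qh x0; have q1 : -1 < q by lra. have q2 : -1 < q + 1 by lra.
have e1 := moment_by_parts q1 x0.
have := moment_by_parts q2 x0.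
have -> : q + 1 + 1 = q + 2 by ring.
rewrite (imomentD1 q1 x0) => e2.
have c := moment_cauchy_schwarz q1 x0.
have b0 := imoment_gt0 q1 x0.
have m0 := moment_gt0 q1 x0; have m1 := moment_gt0 q2 x0.
have x20 : 0 < x ^+ 2 by rewrite exprn_gt0.
move: (moment q x) (moment (q + 1) x) (moment (q + 2) x) (imoment q x) (x ^+ 2) e1 e2 c b0 m0 m1 x20.
move=> I J K B y e1 e2 c b0 m0 m1 y0.
rewrite -subr_gt0 -(pmulr_rgt0 _ (ltr0n _ 2)).
have -> : 2%:R * ((2 * q + 3) * J ^+ 2 - (2 * q + 1) * (I * K)) =
  (2 * q + 3) * J * (2 * J) - (2 * q + 1) * I * (2 * K) by ring.
rewrite e2 e1.
have -> : (2 * q + 3) * J * ((2 * q + 1) * I + y * B) -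
  (2 * q + 1) * I * ((2 * (q + 1) + 1) * J + y * (I - y * B)) =
  y * (2 * (J * B) + (2 * q + 1) * ((J + y * I) * B - I ^+ 2)) by ring.
rewrite mulr_gt0//; apply: ltr_wpDr; last by rewrite !mulr_gt0.
by rewrite mulr_ge0 ?subr_ge0//; lra.
Qed.

End moment_inequalities.

(** * The limit at the origin *)

Section moment_ratio_limit.
Context {R : realType}.
Notation mu := (@lebesgue_measure R).
Implicit Types (q p theta x t : R).

Lemma sqr_imoment_le q x : -1 < q -> 0 < x -> x ^+ 2 * imoment q x <= moment q x.
Proof.
move=> q1 x0; rewrite -subr_ge0 -imomentD1//.
by apply: ltW; apply: imoment_gt0 => //; lra.
Qed.

Lemma powR_ge_quadratic theta (u : R) : 0 < theta <= 1 -> 0 <= u -> u - u ^+ 2 <= u `^ theta.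
Proof.
move=> /andP[th0 th1] u0; have [u1|u1] := leP u 1; last first.
  apply: le_trans (powR_ge0 _ _); rewrite subr_le0 expr2 ler_peMr//; exact: ltW.
have [->|un] := eqVneq u 0; first by rewrite expr0n/= subr0 powR_ge0.
apply: (@le_trans _ _ u); first by rewrite lerBlDr lerDl sqr_ge0.
by apply: ger1_powR; rewrite // u1 lt0r un u0.
Qed.

Lemma moment_ge q x : -1 < q -> 0 < x -> (q + 1 / 2) * moment q x <= moment (q + 1) x.
Proof.
move=> q1 x0; have e := moment_by_parts q1 x0.
have y0 : 0 < x ^+ 2 * imoment q x by rewrite mulr_gt0 ?exprn_gt0 ?imoment_gt0.
move: (moment q x) (moment (q + 1) x) (_ * imoment q x) e y0 => I J B e y0; lra.
Qed.

Lemma moment_le q x : -1 < q -> 0 < x -> moment (q + 1) x <= (q + 1) * moment q x.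
Proof.
move=> q1 x0; have e := moment_by_parts q1 x0; have := sqr_imoment_le q1 x0.
move: (moment q x) (moment (q + 1) x) (_ * imoment q x) e => I J B e h; lra.
Qed.

(** As 2 K <= M J, subtracting K / M^2 removes at most half of J / M. *)
Lemma quadratic_lower_bound c (M I J K P : R) : 0 < c -> 0 < M ->
  c * I <= J -> 2 * K <= M * J -> M^-1 * J - M ^- 2 * K <= P ->
  I <= 2 * M / c * P.
Proof.
move=> c0 M0 IJ KJ JP; rewrite mulrAC ler_pdivlMr// mulrC (le_trans IJ)//.
apply: (@le_trans _ _ (2 * M * (M^-1 * J - M ^- 2 * K))); last first.
  by rewrite ler_pM2l// mulr_gt0.
rewrite -subr_ge0 (_ : _ - _ = M^-1 * (M * J - 2 * K)).
  by rewrite mulr_ge0 ?invr_ge0 ?(ltW M0)// subr_ge0.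
by field; rewrite gt_eqF.
Qed.

(** The inequality u - u^2 <= u^theta at u = s / M, integrated against the
    weight, bounds moment (p + theta) x from below by
    M^theta (I_{p+1} / M - I_{p+2} / M^2), where I_r = moment r x. Now
    (p + 1/2) I_p <= I_{p+1} and I_{p+2} <= (p + 2) I_{p+1}, so
    for M = 2 (p + 2) at least half of the first term survives, uniformly in
    x. *)
Lemma moment_le_shift p theta : - (1 / 2) < p -> 0 < theta <= 1 ->
  exists2 C, 0 < C & forall x, 0 < x -> moment p x <= C * moment (p + theta) x.
Proof.
move=> ph th; have /andP[th0 th1] := th.
have p1 : -1 < p by lra. have p2 : -1 < p + 1 by lra.
have p3 : -1 < p + 1 + 1 by lra. have pth : -1 < p + theta by lra.
have M0 : 0 < 2 * (p + 2) by lra.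
have c0 : 0 < p + 1 / 2 by lra.
set M := 2 * (p + 2) in M0.
exists (2 * M / (p + 1 / 2) / M `^ theta).
  by rewrite divr_gt0 ?powR_gt0// divr_gt0// mulr_gt0.
move=> x x0.
have i1 := integrable_weight p2 x0.
have i2 := integrable_weight p3 x0.
have i3 := integrable_weight pth x0.
have j1 := integrable_itvyZl M^-1 i1.
have j2 := integrable_itvyZl (M ^- 2) i2.
have j3 := integrable_itvyZl (M `^ theta)^-1 i3.
have : \int[mu]_(t in `]x, +oo[) (M^-1 * weight (p + 1) x t - M ^- 2 * weight (p + 1 + 1) x t)
   <= \int[mu]_(t in `]x, +oo[) ((M `^ theta)^-1 * weight (p + theta) x t).
  apply: le_Rintegral => //; first exact: integrable_itvyB.
  move=> t; rewrite /= in_itv/= andbT => xt.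
  have s0 := subr_sqr_gt0 x0 xt.
  rewrite (weightD1 (p + 1))// weightD1// weightD//.
  have := @powR_ge_quadratic theta ((t ^+ 2 - x ^+ 2) / M) th.
  rewrite powR_div ?(ltW s0) ?(ltW M0)// => /(_ (divr_ge0 (ltW s0) (ltW M0))).
  move=> /(ler_wpM2l (weight_ge0 p x t)) k.
  have -> : (M `^ theta)^-1 * (weight p x t * (t ^+ 2 - x ^+ 2) `^ theta) =
      weight p x t * ((t ^+ 2 - x ^+ 2) `^ theta / M `^ theta) by ring.
  apply: le_trans k; rewrite le_eqVlt; apply/orP; left; apply/eqP.
  by field; rewrite gt_eqF.
rewrite RintegralB// !RintegralZl//.
rewrite -/(moment (p + 1) x) -/(moment (p + 1 + 1) x) -/(moment (p + theta) x) => h.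
rewrite -[leRHS]mulrA; apply: quadratic_lower_bound h => //; first exact: moment_ge.
have := moment_le p2 x0; rewrite (_ : p + 1 + 1 = p + 2); last by ring.
by move=> h; rewrite /M -mulrA ler_pM2l.
Qed.

(** x^2 / t^2 <= (x^2 / t^2)^theta <= (x^2 / s)^theta, since x < t and
    s <= t^2. *)
Lemma sqr_imoment_le_shift q theta x : -1 < q - theta -> 0 < theta <= 1 -> 0 < x ->
  x ^+ 2 * imoment q x <= (x ^+ 2) `^ theta * moment (q - theta) x.
Proof.
move=> p1 th x0; have /andP[th0 th1] := th.
have q1 : -1 < q by lra.
have i1 := integrable_weight p1 x0.
have i2 := integrable_weight_div q1 x0.
rewrite /imoment /moment -!RintegralZl//.
apply: le_Rintegral => //; [exact: integrable_itvyZl|exact: integrable_itvyZl|].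
move=> t; rewrite /= in_itv/= andbT => xt.
have s0 := subr_sqr_gt0 x0 xt.
have t0 := lt_trans x0 xt.
have y0 : 0 < x ^+ 2 by rewrite exprn_gt0.
have tt0 : 0 < t ^+ 2 by rewrite exprn_gt0.
have -> : weight q x t = weight (q - theta) x t * (t ^+ 2 - x ^+ 2) `^ theta.
  by rewrite -weightD// subrK.
have -> : x ^+ 2 * (weight (q - theta) x t * (t ^+ 2 - x ^+ 2) `^ theta / t ^+ 2) =
  (x ^+ 2 / t ^+ 2 * (t ^+ 2 - x ^+ 2) `^ theta) * weight (q - theta) x t.
  by ring.
apply: ler_wpM2r; first exact: weight_ge0.
apply: (@le_trans _ _ ((x ^+ 2 / t ^+ 2) `^ theta * (t ^+ 2 - x ^+ 2) `^ theta)).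
  apply: ler_wpM2r; first exact: powR_ge0.
  apply: ger1_powR => //; rewrite divr_gt0//= ler_pdivrMr// mul1r; lra.
have r0 : 0 <= x ^+ 2 / t ^+ 2 by rewrite divr_ge0 ?sqr_ge0.
rewrite -powRM ?(ltW s0)//.
apply: (ge0_ler_powR (ltW th0)); rewrite ?nnegrE ?(ltW y0)//.
  by rewrite mulr_ge0 ?(ltW s0).
rewrite mulrAC ler_pdivrMr// ler_wpM2l ?(ltW y0)//; lra.
Qed.

Lemma cvg_sqr_imoment_ratio q : - (1 / 2) < q ->
  x ^+ 2 * imoment q x / moment q x @[x --> 0^'+] --> (0 : R).
Proof.
move=> qh; pose theta := Num.min 1 (q + 1 / 2) / 2.
(* The minimum keeps theta <= 1; halving keeps q - theta above -1/2. *)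
have [th0 th1 pth] : [/\ 0 < theta, theta <= 1 & - (1 / 2) < q - theta].
  by rewrite /theta; case: (leP 1 (q + 1 / 2)) => ?; split; lra.
have th : 0 < theta <= 1 by rewrite th0.
have [C C0 hC] := moment_le_shift pth th.
apply: (@squeeze_cvgr _ _ _ _ (fun=> 0) (fun x => C * (x `^ theta * x `^ theta))).
- near=> x; have x0 : 0 < x by near: x; exact: nbhs_right_gt.
  have m0 : 0 < moment q x by apply: moment_gt0 => //; lra.
  have b0 : 0 < imoment q x by apply: imoment_gt0 => //; lra.
  apply/andP; split; first by rewrite divr_ge0 ?mulr_ge0 ?sqr_ge0 ?(ltW b0) ?(ltW m0).
  rewrite ler_pdivrMr//.
  apply: (le_trans (@sqr_imoment_le_shift q theta x _ th x0)); first lra.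
  rewrite expr2 powRM ?(ltW x0)//.
  have P0 : 0 <= x `^ theta * x `^ theta by rewrite mulr_ge0 ?powR_ge0.
  move: (_ * _) P0 => P P0; rewrite [C * _]mulrC -mulrA ler_wpM2l//.
  by have := hC x x0; rewrite subrK.
- exact: cvg_cst.
- have h : x `^ theta @[x --> (0 : R)^'+] --> (0 : R) := powR_cvg0 th0.
  have hh : x `^ theta * x `^ theta @[x --> (0 : R)^'+] --> (0 * 0 : R) by exact: cvgM.
  rewrite mulr0 in hh.
  have hC' : C * (x `^ theta * x `^ theta) @[x --> (0 : R)^'+] --> (C * 0 : R).
    by apply: cvgM => //; exact: cvg_cst.
  by rewrite mulr0 in hC'.
Unshelve. all: by end_near. Qed.

Lemma cvg_moment_ratio q : - (1 / 2) < q ->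
  moment (q + 1) x / moment q x @[x --> 0^'+] --> q + 1 / 2.
Proof.
move=> qh; have q1 : -1 < q by lra.
have h : (q + 1 / 2) + (x ^+ 2 * imoment q x / moment q x) * 2^-1 @[x --> 0^'+] --> q + 1 / 2.
  have h0 : (q + 1 / 2) + (x ^+ 2 * imoment q x / moment q x) * 2^-1 @[x --> 0^'+]
      --> (q + 1 / 2) + 0 * 2^-1.
    apply: cvgD; first exact: cvg_cst.
    by apply: cvgM; [exact: cvg_sqr_imoment_ratio|exact: cvg_cst].
  by rewrite mul0r addr0 in h0.
apply: cvg_trans h; apply: near_eq_cvg; near=> x.
have x0 : 0 < x by near: x; exact: nbhs_right_gt.
have m0 := moment_gt0 q1 x0.
have e := moment_by_parts q1 x0.
have -> : moment (q + 1) x = 2^-1 * (2 * moment (q + 1) x) by field.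
by rewrite e; field; rewrite gt_eqF.
Unshelve. all: by end_near. Qed.

End moment_ratio_limit.

(** * From the moments to V *)

Section V_moment.
Context {R : realType}.
Implicit Types (q x : R).

Lemma VE q x : V q x = 2 * expR (x ^+ 2) / Gamma (q + 1) * moment q x.
Proof. by []. Qed.

Lemma VD1E q x : -1 < q ->
  V (q + 1) x = 2 * expR (x ^+ 2) / ((q + 1) * Gamma (q + 1)) * moment (q + 1) x.
Proof. by move=> q1; rewrite VE GammaD1//; lra. Qed.

Lemma VD2E q x : -1 < q ->
  V (q + 2) x = 2 * expR (x ^+ 2) / ((q + 2) * ((q + 1) * Gamma (q + 1))) * moment (q + 2) x.
Proof.
move=> q1; rewrite VE (_ : q + 2 + 1 = q + 1 + 1 + 1); last by ring.
rewrite GammaD1; last by lra.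
rewrite GammaD1; last by lra.
by rewrite (_ : q + 1 + 1 = q + 2); last by ring.
Qed.

Lemma Gamma_V q x : -1 < q -> Gamma (q + 1) * V q x = 2 * expR (x ^+ 2) * moment q x.
Proof.
move=> q1; have G0 : 0 < Gamma (q + 1) by apply: Gamma_gt0; lra.
by rewrite VE; field; rewrite gt_eqF.
Qed.

Lemma V_moment_ratio q x : -1 < q -> 0 < x ->
  V (q + 1) x ^+ 2 / (V q x * V (q + 2) x) =
  (q + 2) / (q + 1) * (moment (q + 1) x ^+ 2 / (moment q x * moment (q + 2) x)).
Proof.
move=> q1 x0.
have G0 : 0 < Gamma (q + 1) by apply: Gamma_gt0; lra.
have q3 : -1 < q + 2 by lra.
have m0 := moment_gt0 q1 x0; have m2 := moment_gt0 q3 x0.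
have e0 := expR_gt0 (x ^+ 2).
rewrite (VD1E x q1) (VD2E x q1) VE.
move: (moment q x) (moment (q + 1) x) (moment (q + 2) x) (expR _) (Gamma _) m0 m2 e0 G0.
move=> I J K e G I0 K0 e0 G0; field.
rewrite (gt_eqF I0) (gt_eqF K0) (gt_eqF e0) (gt_eqF G0)/=; lra.
Qed.

Lemma V_gt0 q x : -1 < q -> 0 < x -> 0 < V q x.
Proof.
move=> q1 x0; rewrite VE mulr_gt0 ?moment_gt0// divr_gt0 ?mulr_gt0 ?expR_gt0//.
by apply: Gamma_gt0; lra.
Qed.

Lemma Gamma_V_log_convex x : 0 < x ->
  strictly_log_convex `]-1, +oo[ (fun q => Gamma (q + 1) * V q x).
Proof.
move=> x0; have k0 : 0 < 2 * expR (x ^+ 2) by rewrite mulr_gt0 ?expR_gt0.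
split=> [q|q1 q2 alpha]; rewrite !in_itv/= !andbT.
  by move=> q1; rewrite Gamma_V// mulr_gt0 ?moment_gt0.
move=> h1 h2 q12 al; have /andP[al0 al1] := al.
have h : -1 < alpha * q1 + (1 - alpha) * q2.
  have : 0 < alpha * (q1 + 1) + (1 - alpha) * (q2 + 1).
    by rewrite addr_gt0// mulr_gt0//; lra.
  lra.
have lc := moment_log_convex x0 h1 h2 q12 al.
have m1 := moment_gt0 h1 x0; have m2 := moment_gt0 h2 x0.
rewrite (Gamma_V x h) (Gamma_V x h1) (Gamma_V x h2).
move: (moment _ x) (moment q1 x) (moment q2 x) (2 * expR _) lc m1 m2 k0.
move=> I I1 I2 k lc m1 m2 k0.
rewrite (powRM _ (ltW k0) (ltW m1)) (powRM _ (ltW k0) (ltW m2)).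
by rewrite mulrACA powR_mul1B// ltr_pM2l.
Qed.

Lemma V_sqr_lt q x : -1 < q -> 0 < x ->
  V (q + 1) x ^+ 2 < (q + 2) / (q + 1) * V q x * V (q + 2) x.
Proof.
move=> q1 x0; have q3 : -1 < q + 2 by lra.
have c0 : 0 < (q + 2) / (q + 1) by apply: divr_gt0; lra.
have V0 : 0 < V q x * V (q + 2) x by apply: mulr_gt0; exact: V_gt0.
have m0 : 0 < moment q x * moment (q + 2) x by apply: mulr_gt0; exact: moment_gt0.
rewrite -mulrA -(ltr_pdivrMr _ _ V0) V_moment_ratio//.
rewrite -[ltRHS]mulr1 (ltr_pM2l c0) (ltr_pdivrMr _ _ m0) mul1r.
exact: moment_sqr_lt.
Qed.

Lemma V_sqr_gt q x : - (1 / 2) < q -> 0 < x ->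
  ((q + 2) * (2 * q + 1)) / ((q + 1) * (2 * q + 3)) * V q x * V (q + 2) x
    < V (q + 1) x ^+ 2.
Proof.
move=> qh x0; have q1 : -1 < q by lra.
have q3 : -1 < q + 2 by lra.
have c0 : 0 < (q + 2) / (q + 1) by apply: divr_gt0; lra.
have V0 : 0 < V q x * V (q + 2) x by apply: mulr_gt0; exact: V_gt0.
have m0 : 0 < moment q x * moment (q + 2) x by apply: mulr_gt0; exact: moment_gt0.
rewrite -mulrA -(ltr_pdivlMr _ _ V0) V_moment_ratio//.
rewrite invfM mulrACA (ltr_pM2l c0) (ltr_pdivlMr _ _ m0) mulrAC ltr_pdivrMr; last by lra.
by rewrite [ltRHS]mulrC; exact: moment_sqr_gt.
Qed.

Lemma cvg_V_ratio q : - (1 / 2) < q ->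
  V (q + 1) x ^+ 2 / (V q x * V (q + 2) x) @[x --> 0^'+] -->
    ((q + 2) * (2 * q + 1)) / ((q + 1) * (2 * q + 3)).
Proof.
move=> qh; have q1 : -1 < q by lra.
have h1 := cvg_moment_ratio qh.
have qh' : - (1 / 2) < q + 1 by lra.
have h2 := cvg_moment_ratio qh'.
have h : (q + 2) / (q + 1) * ((moment (q + 1) x / moment q x) *
    (moment (q + 1 + 1) x / moment (q + 1) x)^-1) @[x --> 0^'+] -->
    (q + 2) / (q + 1) * ((q + 1 / 2) * (q + 1 + 1 / 2)^-1).
  apply: cvgM; first exact: cvg_cst.
  apply: cvgM => //; apply: cvgV => //; lra.
rewrite (_ : _ / _ = (q + 2) / (q + 1) * ((q + 1 / 2) * (q + 1 + 1 / 2)^-1)); last by field; lra.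
apply: cvg_trans h; apply: near_eq_cvg; near=> x.
have x0 : 0 < x by near: x; exact: nbhs_right_gt.
have q2 : -1 < q + 1 by lra.
have q3 : -1 < q + 2 by lra.
rewrite V_moment_ratio// (_ : q + 1 + 1 = q + 2); last by ring.
move: (moment_gt0 q1 x0) (moment_gt0 q2 x0) (moment_gt0 q3 x0).
move: (moment q x) (moment (q + 1) x) (moment (q + 2) x) => I J K I0 J0 K0.
clear h1 h2; field; rewrite (gt_eqF I0) (gt_eqF J0) (gt_eqF K0)/=; lra.
Unshelve. all: by end_near. Qed.

End V_moment.

Theorem theorem4 (R : realType) :
  (forall x : R, 0 < x ->
     strictly_log_convex `]-1, +oo[ (fun q => Gamma (q + 1) * V q x)) /\
  (forall q x : R, - (1 / 2) < q -> 0 < x ->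
     ((q + 2) * (2 * q + 1)) / ((q + 1) * (2 * q + 3)) * V q x * V (q + 2) x
       < V (q + 1) x ^+ 2 /\
     V (q + 1) x ^+ 2 < (q + 2) / (q + 1) * V q x * V (q + 2) x) /\
  (forall q x : R, -1 < q -> 0 < x ->
     V (q + 1) x ^+ 2 < (q + 2) / (q + 1) * V q x * V (q + 2) x) /\
  (forall q : R, - (1 / 2) < q ->
     V (q + 1) x ^+ 2 / (V q x * V (q + 2) x) @[x --> 0^'+] -->
       ((q + 2) * (2 * q + 1)) / ((q + 1) * (2 * q + 3))).
Proof.
split; first exact: Gamma_V_log_convex.
split.
  move=> q x qh x0; split; first exact: V_sqr_gt.
  by apply: V_sqr_lt => //; lra.
split; first exact: V_sqr_lt.
exact: cvg_V_ratio.
Qed.
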